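(* Let $I$ be a finite index set and let $\{T_i\}_{i\in I}$ be a collection of nonexpansive operators $T_i\colon X\to X$ with a common fixed point. Define a sequence $(x_n)_{n\in\mathbb{N}}$ with starting point $x_0\in X$ according to $$\forall n\in\mathbb{N},\quad x_{n+1}:=(1-\lambda_n)x_n+\lambda_nT_{i_n}(x_n),$$ where $(i_n)_{n\in\mathbb{N}}\subseteq I$ is admissible in $I$, and $(\lambda_n)_{n\in\mathbb{N}}$ is in $(0,1]$ with $\liminf_{n\to\infty}\lambda_n(1-\lambda_n)>0$. Then $(x_n)_{n\in\mathbb{N}}$ converges to a point $\overline{x}\in\bigcap_{i\in I}\operatorname{Fix}T_i$.
   Context: $X$ is a real finite-dimensional Hilbert space with norm $\|\cdot\|$. $T\colon X\to X$ is nonexpansive if $\|Tx-Ty\|\le\|x-y\|$ for all $x,y\in X$; $\operatorname{Fix}T=\{x\in X:T(x)=x\}$. Given nonempty finite sets $I^*\subseteq I$, a sequence $(i_n)_{n\in\mathbb{N}}\subseteq I$ is admissible in $I^*$ if every element of $I^*$ appears infinitely often in $(i_n)_{n\in\mathbb{N}}$. *)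

(* Defs.v *)
From HB Require Import structures.
From mathcomp Require Import all_boot all_order all_algebra.
From mathcomp Require Import all_classical all_reals all_analysis.

Set Implicit Arguments.
Unset Strict Implicit.
Unset Printing Implicit Defensive.

Import Order.TTheory GRing.Theory Num.Theory.
Import numFieldNormedType.Exports.

Local Open Scope classical_set_scope.
Local Open Scope ring_scope.

(* The topology of a [normedModType] is by construction that of its norm, and
   completeness is automatic in finite dimension, so neither needs an axiom. *)
HB.mixin Record isInnerProductSpace (R : realType) (X : Type)
    of NormedModule R X := {
  inner : {dot X for (@idfun R)} ;
  normE_inner : forall x : X, `|x| = Num.sqrt (inner x x) }.

#[short(type="finHilbertType")]
HB.structure Definition FinHilbert (R : realType) :=
  { X of NormedModule R X & Vector R X & isInnerProductSpace R X }.

Definition nonexpansive (R : realType) (X : normedModType R) (T : X -> X) :=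
  forall x y : X, `|T x - T y| <= `|x - y|.

Definition Fix (X : Type) (T : X -> X) : set X := [set x | T x = x].

Definition admissible (I : finType) (J : set I) (i : nat -> I) :=
  forall j, J j -> infinite_set [set n | i n = j].

(* Main.v *)
Require Import Defs.
From mathcomp Require Import all_boot all_order all_algebra.
From mathcomp Require Import all_classical all_reals all_analysis.
From mathcomp Require Import ring lra.

Set Implicit Arguments.
Unset Strict Implicit.
Unset Printing Implicit Defensive.

Import Order.TTheory GRing.Theory Num.Theory.
Import numFieldNormedType.Exports.

Local Open Scope classical_set_scope.
Local Open Scope ring_scope.

(** The iteration is Fejer monotone: a relaxed nonexpansive step moves no
    point away from a fixed point of its operator, and the squared distance drops
    by at least [l * (1 - l)] times the squared residual ([fejer_step]).
    Applied to a common fixed point, this bounds the orbit, so that it has a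
    cluster point [q] by compactness of balls, and it makes the weighted squared
    residuals summable.  As the weights [lam n * (1 - lam n)] are eventually
    bounded away from [0], the residuals [`|x n - T (i n) (x n)|] vanish
    ([residual_cvg0]).

    The core is that [q] is fixed by every operator ([cluster_fixed]), although
    a given operator may be applied at arbitrarily sparse times.  Suppose that
    some operators move [q]; as they are finitely many, they move it by at least
    some [r > 0].  Wait until the residuals are small, then until [x n] is close
    to [q], and let [m >= n] be the first time at which an operator that moves
    [q] is applied; admissibility provides one.  Between [n] and [m] only
    operators fixing [q] are used, so by Fejer monotonicity with respect to [q]
    the point [x m] is still close to [q].  Then [T (i m)] nearly fixes [x m],
    hence moves [q] by less than [r], a contradiction.

    Finally [q] is itself a common fixed point, so the distance to [q] is
    nonincreasing; it is arbitrarily small at some times, hence tends to [0]. *)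

(** * Relaxed nonexpansive steps *)

Lemma sqr_norm_inner (R : realType) (X : finHilbertType R) (u : X) :
  `|u| ^+ 2 = inner u u.
Proof.
rewrite normE_inner sqr_sqrtr//.
have [->|u0] := eqVneq u 0; first by rewrite linear0r.
exact/ltW/neq0_dnorm_gt0.
Qed.

(** The exact convexity defect of the squared norm: the one property of Hilbert
    spaces, as opposed to normed spaces, on which the convergence rests. *)
Lemma sqr_norm_convex (R : realType) (X : finHilbertType R) (l : R) (u v : X) :
  `|(1 - l) *: u + l *: v| ^+ 2 =
  (1 - l) * `|u| ^+ 2 + l * `|v| ^+ 2 - l * (1 - l) * `|u - v| ^+ 2.
Proof.
rewrite !sqr_norm_inner.
rewrite hnormD hnormB /= expr0 mul1r.
rewrite !(linearZl_LR, linearZr_LR) /=.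
rewrite /GRing.scale /=; ring.
Qed.

(** The distance from [T u] to [p] is at most that from [u] to [p], so
    [sqr_norm_convex] applied to [u - p] and [T u - p] leaves only the defect
    term, in which [p] cancels. *)
Lemma fejer_step (R : realType) (X : finHilbertType R) (T : X -> X) (l : R)
    (p u : X) :
  nonexpansive T -> T p = p -> 0 <= l ->
  `|(1 - l) *: u + l *: T u - p| ^+ 2 <=
  `|u - p| ^+ 2 - l * (1 - l) * `|u - T u| ^+ 2.
Proof.
move=> nT Tp l0.
have -> : (1 - l) *: u + l *: T u - p = (1 - l) *: (u - p) + l *: (T u - p).
  by rewrite !scalerBr addrACA -opprD -scalerDl subrK scale1r.
rewrite sqr_norm_convex opprB addrA subrK.
have : `|T u - p| ^+ 2 <= `|u - p| ^+ 2.
  by rewrite lerXn2r ?nnegrE// -{1}Tp; exact: nT.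
move=> /(ler_wpM2l l0); lra.
Qed.

Lemma fejer_step_le (R : realType) (X : finHilbertType R) (T : X -> X) (l : R)
    (p u : X) :
  nonexpansive T -> T p = p -> 0 <= l <= 1 ->
  `|(1 - l) *: u + l *: T u - p| <= `|u - p|.
Proof.
move=> nT Tp /andP[l0 l1].
rewrite -(@ler_pXn2r _ 2)// ?nnegrE//.
apply: le_trans (fejer_step u nT Tp l0) _.
by rewrite gerBl mulr_ge0 ?mulr_ge0 ?subr_ge0 ?exprn_ge0.
Qed.

(** * Compactness of balls in finite dimension *)

Section compact_balls.
Variables (R : realType) (X : finHilbertType R).

Let n := \dim {:X}.
Let b := vbasis {:X}.

Definition of_coords (v : 'rV[R]_n) : X := \sum_(j < n) v ord0 j *: b`_j.

Lemma of_coordsZ a v : of_coords (a *: v) = a *: of_coords v.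
Proof.
by rewrite /of_coords scaler_sumr; apply: eq_bigr => j _; rewrite mxE scalerA.
Qed.

Lemma of_coords_eq0 v : of_coords v = 0 -> v = 0.
Proof.
move=> v0; apply/rowP => j; rewrite mxE.
exact: (freeP (basis_free (vbasisP {:X})) _ v0).
Qed.

Lemma of_coords_surj u : exists v, of_coords v = u.
Proof.
exists (\row_j coord b j u); rewrite [RHS](coord_vbasis (memvf u)).
by apply: eq_bigr => j _; rewrite mxE.
Qed.

Lemma of_coords_continuous : continuous of_coords.
Proof.
rewrite (_ : of_coords = \sum_(j < n) (fun v : 'rV[R]_n => v ord0 j *: b`_j)).
  apply: (big_ind (fun f : 'rV[R]_n -> X => continuous f)) => [v|f g cf cg v|j _ v].
  - exact: cst_continuous.
  - exact: (cvgD (cf v) (cg v)).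
  - exact: cvgZr_tmp (@coord_continuous R 1 n ord0 j v).
by apply/funext => v; rewrite fct_sumE.
Qed.

(** One half of the equivalence of norms in finite dimension: the image norm is
    continuous and nonzero on the compact unit sphere of the coordinate space,
    so it has a positive minimum there, and homogeneity does the rest. *)
Lemma of_coords_norm_ge : exists2 c : R, 0 < c &
  forall v, c * `|v| <= `|of_coords v|.
Proof.
pose S := [set v : 'rV[R]_n | `|v| = 1].
(* In dimension 0 the sphere is empty, and then every vector is zero. *)
have [S0|/set0P/negP/negPn/eqP S0] := pselect (S !=set0); last first.
  exists 1 => // v; have [->|v0] := eqVneq v 0; first by rewrite normr0 mulr0.
  suff : S (`|v|^-1 *: v) by rewrite S0.
  by rewrite /S /= normrZ normfV normr_id mulVf ?normr_eq0.
have cS : compact S.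
  apply: bounded_closed_compact.
    by exists 1; split => // M M1 v; rewrite /S /= => ->; exact: ltW.
  rewrite (_ : S = Num.norm @^-1` [set 1]) //.
  by apply: preimage_closed => [v _|]; [exact: norm_continuous|exact: closed_eq].
have [|w wS wmin] := compact_EVT_min (f := fun v => `|of_coords v|) S0 cS.
  apply: continuous_subspaceT => v.
  exact: cvg_norm (@of_coords_continuous v).
rewrite inE in wS.
exists `|of_coords w|.
  rewrite normr_gt0; apply/eqP => /of_coords_eq0 w0.
  by move: wS; rewrite /S /= w0 normr0 => /esym/eqP; rewrite oner_eq0.
move=> v; have [->|v0] := eqVneq v 0; first by rewrite normr0 mulr0.
rewrite -ler_pdivlMr ?normr_gt0//.
have := wmin (`|v|^-1 *: v); rewrite of_coordsZ normrZ normfV normr_id mulrC.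
by apply; rewrite inE /S /= normrZ normfV normr_id mulVf ?normr_eq0.
Qed.

(** A ball is closed, and by [of_coords_norm_ge] it lies in the continuous image
    of a ball of the coordinate space. *)
Lemma closed_ball_compact (M : R) : compact [set u : X | `|u| <= M].
Proof.
have [c c0 cP] := of_coords_norm_ge.
apply: (@subclosed_compact _ _ (of_coords @` [set v | `|v| <= M / c])).
- rewrite (_ : [set u : X | _] = Num.norm @^-1` [set r | r <= M]) //.
  by apply: preimage_closed => [u _|]; [exact: norm_continuous|exact: closed_le].
- apply: continuous_compact.
    exact/continuous_subspaceT/of_coords_continuous.
  apply: bounded_closed_compact.
    exists (M / c); split; first exact: num_real.
    by move=> N MN v /le_trans; apply; exact: ltW.
  rewrite (_ : [set v | _] = Num.norm @^-1` [set r | r <= M / c]) //.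
  by apply: preimage_closed => [u _|]; [exact: norm_continuous|exact: closed_le].
- move=> u /= uM; have [v vu] := of_coords_surj u.
  by exists v => //=; rewrite ler_pdivlMr// mulrC (le_trans (cP v))// vu.
Qed.

Lemma bounded_seq_cluster (x : nat -> X) (p : X) (M : R) :
  (forall n, `|x n - p| <= M) ->
  exists xbar, forall (N : nat) (e : R), 0 < e ->
    exists2 n, (N <= n)%N & `|x n - xbar| < e.
Proof.
move=> xM.
have [|xbar [_ cl]] := closed_ball_compact (M := M + `|p|) (F := x @ \oo) _.
  exists 0%N => // k _ /=.
  by rewrite -(subrK p (x k)) (le_trans (ler_normD _ _))// lerD2r.
exists xbar => N e e0.
have [||_ [[k Nk <-] xe]] := cl (x @` [set k | (N <= k)%N]) (ball xbar e).
- by exists N => // k Nk; exists k.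
- exact: nbhsx_ballx.
- by exists k => //; rewrite distrC; move: xe; rewrite -ball_normE.
Qed.

End compact_balls.

(** * Limits of real sequences *)

(** The lower limit is the limit of the tail infima, so one of these is already
    positive; it is the constant [c]. *)
Lemma limn_einf_gt0_near (R : realType) (u : nat -> R) :
  (0 < limn_einf (fun n => (u n)%:E))%E ->
  exists2 c : R, 0 < c & \forall n \near \oo, c <= u n.
Proof.
rewrite limn_einf_lim => lim0.
have [N eN] : exists N, (0 < einfs (fun n => (u n)%:E) N)%E.
  apply/not_existsP => all0; move: lim0; apply/negP; rewrite -leNgt.
  apply: lime_le; first exact: is_cvg_einfs.
  by apply: nearW => N; rewrite leNgt; apply/negP.
have ebound n : (N <= n)%N -> (einfs (fun n => (u n)%:E) N <= (u n)%:E)%E.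
  by move=> Nn; apply: ereal_inf_lbound; exists n.
case: (einfs _ N) eN ebound => [c||//] eN ebound; last first.
  by have := ebound N (leqnn N).
by exists c => //; exists N => // n /ebound; rewrite lee_fin.
Qed.

(** Decreasing and bounded below, [a] converges; its successive differences
    dominate [c n * r n ^+ 2] and tend to [0]. *)
Lemma residual_cvg0_of_decrease (R : realType) (a c r : nat -> R) (d : R) :
  (forall n, 0 <= a n) -> (forall n, 0 <= r n) -> (forall n, 0 <= c n) ->
  (forall n, a n.+1 <= a n - c n * r n ^+ 2) ->
  0 < d -> (\forall n \near \oo, d <= c n) ->
  r n @[n --> \oo] --> 0.
Proof.
move=> a0 r0 c0 step d0 dc.
have acvg : cvgn a.
  apply: nonincreasing_is_cvgn; last by exists 0 => _ [n _ <-].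
  apply/nonincreasing_seqP => n; apply: le_trans (step n) _.
  by rewrite gerBl mulr_ge0 ?exprn_ge0.
have diff0 : a n - a n.+1 @[n --> \oo] --> 0.
  rewrite -(subrr (limn a)); apply: cvgB => //.
  by rewrite cvg_shiftS.
apply/cvgr0Pnorm_lt => e e0.
have de : 0 < d * e ^+ 2 by rewrite mulr_gt0 ?exprn_gt0.
move/cvgr0Pnorm_lt : diff0 => /(_ _ de) diffe.
near=> n.
rewrite ger0_norm// -(@ltr_pXn2r _ 2)// ?nnegrE//; last exact: ltW.
rewrite -(ltr_pM2l d0).
have : d * r n ^+ 2 <= c n * r n ^+ 2.
  by rewrite ler_wpM2r ?exprn_ge0//; near: n.
have : `|a n - a n.+1| < d * e ^+ 2 by near: n.
move/(le_lt_trans (ler_norm _)).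
have := step n.
lra.
Unshelve. all: by end_near. Qed.

(** * The iteration *)

Lemma admissible_ge (I : finType) (J : set I) (i : nat -> I) (j : I) (n : nat) :
  admissible J i -> J j -> exists2 m, (n <= m)%N & i m = j.
Proof.
move=> adm Jj; apply: contrapT => none; apply: (adm _ Jj).
apply: (sub_finite_set _ (finite_II n)) => m /= imj.
by rewrite ltnNge; apply/negP => nm; apply: none; exists m.
Qed.

Section iteration.
Variables (R : realType) (X : finHilbertType R) (I : finType).
Variables (T : I -> X -> X) (i : nat -> I) (lam : nat -> R) (x : nat -> X).
Hypothesis T_nonexpansive : forall k, nonexpansive (T k).
Hypothesis lam01 : forall n, 0 < lam n <= 1.
Hypothesis xS :
  forall n, x n.+1 = (1 - lam n) *: x n + lam n *: T (i n) (x n).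

(** Asking [p] to be fixed only by the operators used between [n] and [m], and not
    by all of them, is what allows taking for [p] a cluster point before it is
    known to be a common fixed point. *)
Lemma dist_noninc_while_fixed (p : X) (n m : nat) :
  (n <= m)%N -> (forall k, (n <= k < m)%N -> T (i k) p = p) ->
  `|x m - p| <= `|x n - p|.
Proof.
move=> /subnKC <-; elim: (m - n)%N => [|k IH] fixp; first by rewrite addn0.
rewrite addnS xS; apply: (@le_trans _ _ `|x (n + k)%N - p|).
  apply: fejer_step_le => //; last by case/andP: (lam01 (n + k)) => /ltW ->.
  by apply: fixp; rewrite leq_addr addnS ltnS leqnn.
by apply: IH => l /andP[nl lk]; apply: fixp; rewrite nl addnS ltnS ltnW.
Qed.

Lemma residual_cvg0 (p : X) :
  (forall k, T k p = p) ->
  (0 < limn_einf (fun n => (lam n * (1 - lam n))%:E))%E ->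
  `|x n - T (i n) (x n)| @[n --> \oo] --> (0 : R).
Proof.
move=> fixp /limn_einf_gt0_near[c c0 clam].
apply: (@residual_cvg0_of_decrease _ (fun n => `|x n - p| ^+ 2)
  (fun n => lam n * (1 - lam n)) _ c) => //.
- by move=> n; case/andP: (lam01 n) => /ltW l0 l1; rewrite mulr_ge0 ?subr_ge0.
- move=> n; rewrite xS; apply: fejer_step => //.
  by case/andP: (lam01 n) => /ltW.
Qed.

(** The argument with the first operator that moves [q], applied after the orbit
    has come close to [q]; [r / 3] leaves room for the residual at [x m] and for
    two copies of the distance from [x m] to [q]. *)
Lemma cluster_fixed (q : X) :
  admissible [set: I] i ->
  `|x n - T (i n) (x n)| @[n --> \oo] --> (0 : R) ->
  (forall (N : nat) (e : R), 0 < e ->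
    exists2 n, (N <= n)%N & `|x n - q| < e) ->
  forall k, T k q = q.
Proof.
move=> adm res0 clq k0; apply: contrapT => /eqP k0q.
(* The default [1] keeps the minimum positive and is harmless: only [r > 0] and
   [r <= `|T k q - q|] for the operators moving [q] are needed. *)
pose r := \big[Num.min/1]_(k | T k q != q) `|T k q - q|.
have r0 : 0 < r.
  by apply: lt_bigmin => // k kq; rewrite normr_gt0 subr_eq0.
have r3 : 0 < r / 3 by rewrite divr_gt0.
move/cvgr0Pnorm_lt : res0 => /(_ _ r3)[N _ resN].
have [n Nn xnq] := clq N _ r3.
have ex_moving : exists m, (n <= m)%N && (T (i m) q != q).
  have [m nm imk0] := admissible_ge n adm (Logic.I : [set: I] k0).
  by exists m; rewrite nm imk0.
case: (ex_minnP ex_moving) => m /andP[nm mq] m_min.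
have xmq : `|x m - q| < r / 3.
  apply: le_lt_trans xnq; apply: dist_noninc_while_fixed => // k /andP[nk km].
  apply/eqP/negPn/negP => kq.
  by have := m_min k; rewrite nk kq leqNgt km => /(_ isT).
have resm : `|x m - T (i m) (x m)| < r / 3.
  by have := resN m (leq_trans Nn nm); rewrite /= normr_id.
have : r <= `|T (i m) q - q| by exact: bigmin_le_cond.
have -> : T (i m) q - q =
    (T (i m) q - T (i m) (x m)) - (x m - T (i m) (x m)) + (x m - q).
  by rewrite opprB !addrA subrK subrK.
have : `|T (i m) q - T (i m) (x m)| <= `|x m - q|.
  by rewrite [leRHS]distrC; exact: T_nonexpansive.
have := ler_normD (T (i m) q - T (i m) (x m) - (x m - T (i m) (x m))) (x m - q).
have := ler_normB (T (i m) q - T (i m) (x m)) (x m - T (i m) (x m)).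
lra.
Qed.

End iteration.

Theorem theorem4p1 (R : realType) (X : finHilbertType R) (I : finType)
    (T : I -> X -> X) (i : nat -> I) (lam : nat -> R) (x : nat -> X) :
  (forall k : I, nonexpansive (T k)) ->
  \bigcap_(k in [set: I]) Fix (T k) !=set0 ->
  admissible [set: I] i ->
  (forall n : nat, 0 < lam n <= 1) ->
  (0 < limn_einf (fun n : nat => (lam n * (1 - lam n))%:E))%E ->
  (forall n : nat,
     x n.+1 = (1 - lam n) *: x n + lam n *: T (i n) (x n)) ->
  exists2 xbar : X,
    (\bigcap_(k in [set: I]) Fix (T k)) xbar & x n @[n --> \oo] --> xbar.
Proof.
move=> nT [p pfix] adm lam01 liminf xS.
have Tp k : T k p = p by exact: pfix.
have [q clq] : exists q, forall (N : nat) (e : R), 0 < e ->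
    exists2 n, (N <= n)%N & `|x n - q| < e.
  apply: (@bounded_seq_cluster _ _ x p `|x 0%N - p|) => n.
  exact: (@dist_noninc_while_fixed _ _ _ T i lam).
have res0 := residual_cvg0 nT lam01 xS Tp liminf.
have Tq := cluster_fixed nT lam01 xS adm res0 clq.
exists q => [k _|]; first exact: Tq.
apply/cvgrPdist_lt => e e0; have [N _ xNq] := clq 0%N e e0.
exists N => // m Nm /=; rewrite distrC; apply: le_lt_trans xNq.
exact: (@dist_noninc_while_fixed _ _ _ T i lam).
Qed.
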